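(* Let $p_c:\mathrm{GF}(2)^n\to\mathrm{GF}(2)$ be the clique function in $n$ variables, $p_c(\mathbf{x})=\sum_{0\le i<j\le n-1}x_ix_j$, and let $K_n^{IHN}$ be the number of flat spectra of $p_c$ with respect to $\{I,H,N\}^n$. Then $K_n^{IHN}=2K_{n-1}^{IHN}+2^{n}$; in closed form, $$K_n^{IHN}=(n+1)2^{n-1}.$$
   Context: Let $I$ be the $2\times 2$ identity matrix, $H=\frac{1}{\sqrt2}\begin{pmatrix}1&1\\1&-1\end{pmatrix}$, and $N=\frac{1}{\sqrt2}\begin{pmatrix}1&i\\1&-i\end{pmatrix}$ with $i^2=-1$. $\{I,H,N\}^n$ denotes the set of $3^n$ transforms $U=U_0\otimes U_1\otimes\cdots\otimes U_{n-1}$ with each $U_j\in \{I,H,N\}$ (the factor $U_j$ acts on the tensor position of variable $x_j$); each transform is identified with the choice $(U_0,\ldots,U_{n-1})$. For a Boolean function $p:\mathrm{GF}(2)^n\to\mathrm{GF}(2)$, let $(-1)^{p}\in\mathbb{C}^{2^n}$ be the vector with entries $(-1)^{p(\mathbf{x})}$ indexed by $\mathbf{x}=(x_0,\ldots,x_{n-1})\in\mathrm{GF}(2)^n$. The spectrum of $p$ with respect to $U$ is $P=U(-1)^p=(P_{\mathbf{k}})_{\mathbf{k}\in\mathrm{GF}(2)^n}$, and it is flat if $|P_{\mathbf{k}}|=1$ for all $\mathbf{k}$. The number of flat spectra of $p$ with respect to $\{I,H,N\}^n$ is the number of choices $(U_0,\ldots,U_{n-1})$ for which the spectrum of $p$ is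 flat.
   Formalization: The printed recurrence K_n = 2K_{n-1} + 2^n is false (n = 2 gives 8, but K_2 = 6) and contradicts the closed form; it is stated in the corrected form K_n = 2K_{n-1} + 2^{n-1} for n ≥ 2, and the closed form is stated for n ≥ 1. *)

(* Defs.v *)
From HB Require Import structures.
From mathcomp Require Import all_boot all_order all_algebra.
From mathcomp Require Import complex.
From mathcomp Require Import reals.

Set Implicit Arguments.
Unset Strict Implicit.
Unset Printing Implicit Defensive.

Import Order.TTheory GRing.Theory Num.Theory.
Local Open Scope ring_scope.

(* MathComp world.  GF(2)^n is 'rV['F_2]_n, and vectors of C^(2^n) are functions
   'rV['F_2]_n -> C; the complex numbers are R[i] for R : realType. *)

Definition mx2 (C : numClosedFieldType) (a b c d : C) : 'M[C]_2 :=
  \matrix_(i < 2, j < 2)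
    if i == 0 then (if j == 0 then a else b) else (if j == 0 then c else d).

Definition Hmx (C : numClosedFieldType) : 'M[C]_2 := (sqrtC 2)^-1 *: mx2 1 1 1 (-1).
Definition Nmx (C : numClosedFieldType) : 'M[C]_2 := (sqrtC 2)^-1 *: mx2 1 'i 1 (- 'i).

Inductive ihn := TI | TH | TN.

Definition ord_of_ihn (t : ihn) : 'I_3 :=
  match t with TI => inord 0 | TH => inord 1 | TN => inord 2 end.
Definition ihn_of_ord (i : 'I_3) : ihn :=
  match val i with 0%N => TI | 1%N => TH | _ => TN end.
Lemma ord_of_ihnK : cancel ord_of_ihn ihn_of_ord.
Proof. by case; rewrite /ihn_of_ord /= inordK. Qed.

HB.instance Definition _ := Finite.copy ihn (can_type ord_of_ihnK).

Definition ihn_mx (C : numClosedFieldType) (t : ihn) : 'M[C]_2 :=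
  match t with TI => 1%:M | TH => Hmx C | TN => Nmx C end.

(* The (k, x) entry of the Kronecker product U_0 (x) ... (x) U_(n-1), its rows
   and columns being indexed by GF(2)^n instead of {0, ..., 2^n - 1}; 'F_2 is
   convertible to 'I_2, so bits index the 2 x 2 factors directly. *)
Definition tensor (C : numClosedFieldType) (n : nat) (U : 'I_n -> 'M[C]_2)
    (k x : 'rV['F_2]_n) : C :=
  \prod_(j < n) U j (k 0 j) (x 0 j).

(* In the exponent, p x : 'F_2 is coerced to its representative 0 or 1. *)
Definition spectrum (C : numClosedFieldType) (n : nat)
    (p : 'rV['F_2]_n -> 'F_2) (U : {ffun 'I_n -> ihn}) (k : 'rV['F_2]_n) : C :=
  \sum_(x : 'rV['F_2]_n) tensor (fun j => ihn_mx C (U j)) k x * (-1) ^+ p x.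

Definition flat (C : numClosedFieldType) (n : nat) (P : 'rV['F_2]_n -> C) : bool :=
  [forall k, `|P k| == 1].

Definition num_flat_spectra (C : numClosedFieldType) (n : nat)
    (p : 'rV['F_2]_n -> 'F_2) : nat :=
  #|[set U : {ffun 'I_n -> ihn} | flat (spectrum C p U)]|.

Definition clique (n : nat) (x : 'rV['F_2]_n) : 'F_2 :=
  \sum_(i < n) \sum_(j < n | (i < j)%N) x 0 i * x 0 j.

Definition K_IHN (C : numClosedFieldType) (n : nat) : nat :=
  num_flat_spectra C (@clique n).

(* Main.v *)
Require Import Defs.
From mathcomp Require Import all_boot all_order all_algebra.
From mathcomp Require Import complex.
From mathcomp Require Import reals.
From mathcomp Require Import ring.

Import GRing.Theory Num.Theory.

Local Open Scope ring_scope.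

(** If x has weight w then clique x = 'C(w, 2) mod 2, hence
    (-1)^(clique x) = ((1 - i) i^w + (1 + i) (-i)^w) / 2.
    Each spectral value is therefore a combination of two products of local
    factors.  The factors of I and H are eighth roots of unity (primitive ones
    for H), those of N are 0 or sqrt 2, vanishing for i and -i at opposite
    bits.  So the spectrum is flat iff there is exactly one N, or no N and an
    even number of H's: this gives n 2^(n-1) + 2^(n-1) transforms. *)

(** * Small sums and the sign of the clique function *)

Lemma F2_cases (b : 'F_2) : b = 0 \/ b = 1.
Proof. by case: b => [[|[|//]] lt_b]; [left|right]; apply: val_inj. Qed.

Lemma sum_F2 (V : nmodType) (F : 'F_2 -> V) : \sum_b F b = F 0 + F 1.
Proof.
rewrite big_ord_recl big_ord1.
by congr (F _ + F _); apply: val_inj.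
Qed.

Lemma ihn_eqE :
  ((TI == TH) = false) * ((TI == TN) = false) * ((TH == TI) = false) *
  ((TH == TN) = false) * ((TN == TI) = false) * ((TN == TH) = false).
Proof. by do !split; apply/eqP. Qed.

Lemma sum_ihn (V : nmodType) (F : ihn -> V) : \sum_t F t = F TI + F TH + F TN.
Proof.
rewrite (bigD1 TI) //= (bigD1 TH) ?ihn_eqE //= (bigD1 TN) ?ihn_eqE //=.
by rewrite big1 ?addr0 ?addrA //; case; rewrite ?eqxx ?ihn_eqE.
Qed.

(** The exponents are representatives in {0, 1}, so 1 + 1 wraps around to 0; this is harmless
    because (-1)^2 = 1. *)
Lemma sign_F2D (S : pzRingType) (a b : 'F_2) :
  (-1) ^+ (a + b)%R = (-1) ^+ a * (-1) ^+ b :> S.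
Proof.
by case: (F2_cases a) => ->; case: (F2_cases b) => ->;
  rewrite /= ?expr0 ?expr1 ?mulr1 ?mul1r // mulrNN mulr1.
Qed.

Lemma sign_F2_sum (S : pzRingType) (n : nat) (f : 'I_n -> 'F_2) :
  (-1) ^+ (\sum_i f i)%R = \prod_i (-1) ^+ f i :> S.
Proof.
elim: n f => [|n IHn] f; first by rewrite !big_ord0.
by rewrite !big_ord_recl sign_F2D IHn.
Qed.

Lemma sum_pairs_recl (S : pzSemiRingType) (n : nat) (x : 'I_n.+1 -> S) :
  \sum_(i < n.+1) \sum_(j < n.+1 | (i < j)%N) x i * x j =
  x ord0 * (\sum_(i < n) x (lift ord0 i)) +
  \sum_(i < n) \sum_(j < n | (i < j)%N) x (lift ord0 i) * x (lift ord0 j).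
Proof.
rewrite big_ord_recl mulr_sumr; congr (_ + _).
  by rewrite big_mkcond big_ord_recl /= add0r.
apply: eq_bigr => i _; rewrite big_mkcond big_ord_recl /= add0r.
by rewrite -big_mkcond.
Qed.

(** Induction removing x_0. If x_0 = 1, the clique gains the sum of the other bits, whose sign
    exchanges the two products; the coefficients then agree because (1 - i) i = 1 + i and (1 +
    i)(-i) = 1 - i. *)
Lemma sign_clique (C : numClosedFieldType) (n : nat) (x : 'I_n -> 'F_2) :
  (-1) ^+ (\sum_(i < n) \sum_(j < n | (i < j)%N) x i * x j)%R =
  (1 - 'i) / 2 * \prod_j 'i ^+ x j + (1 + 'i) / 2 * \prod_j (- 'i) ^+ x j :> C.
Proof.
have i2 : 'i * 'i = -1 :> C by rewrite -expr2 sqrCi.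
elim: n x => [|n IHn] x; first by rewrite !big_ord0; field.
rewrite sum_pairs_recl !(big_ord_recl _ (fun j => _ ^+ _)) sign_F2D.
rewrite (IHn (fun i => x (lift ord0 i))).
case: (F2_cases (x ord0)) => ->; first by rewrite mul0r !expr0 !mul1r.
rewrite mul1r sign_F2_sum mulrDr ![_ * (_ / 2 * _)]mulrCA -!big_split /=.
have swap (e : C) : \prod_(j < n) ((-1) ^+ x (lift ord0 j) * e ^+ x (lift ord0 j)) =
    \prod_(j < n) (- e) ^+ x (lift ord0 j).
  by apply: eq_bigr => j _; rewrite -exprMn mulN1r.
rewrite !swap opprK !expr1; ring: i2.
Qed.

(** * Local factors of the spectrum *)

Definition factor (C : numClosedFieldType) (e : C) (t : ihn) (b : 'F_2) : C :=
  ihn_mx C t b 0 + ihn_mx C t b 1 * e.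

(** A tensor product acts on a product vector position by position: [factor e t b] is entry [b] of
    the transform [t] applied to (1, e). *)
Lemma sum_tensor (C : numClosedFieldType) (n : nat) (U : 'I_n -> ihn)
    (e : C) (k : 'rV['F_2]_n) :
  \sum_(x : 'rV['F_2]_n)
    tensor (fun j => ihn_mx C (U j)) k x * \prod_j e ^+ x 0 j =
  \prod_j factor C e (U j) (k 0 j).
Proof.
under [RHS]eq_bigr => j _.
  rewrite (_ : factor _ _ _ _ = \sum_b ihn_mx C (U j) (k 0 j) b * e ^+ b).
    over.
  by rewrite sum_F2 expr0 expr1 mulr1.
rewrite bigA_distr_bigA (reindex (fun f : {ffun 'I_n -> 'F_2} => \row_j f j)) /=.
  apply: eq_bigr => f _; rewrite -big_split /=.
  by apply: eq_bigr => j _; rewrite mxE.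
exists (fun x : 'rV['F_2]_n => [ffun j => x 0 j]) => [f _|x _].
  by apply/ffunP => j; rewrite ffunE mxE.
by apply/rowP => j; rewrite mxE ffunE.
Qed.

Lemma spectrum_clique (C : numClosedFieldType) (n : nat)
    (U : {ffun 'I_n -> ihn}) (k : 'rV['F_2]_n) :
  spectrum C (@clique n) U k =
  (1 - 'i) / 2 * \prod_j factor C 'i (U j) (k 0 j) +
  (1 + 'i) / 2 * \prod_j factor C (- 'i) (U j) (k 0 j).
Proof.
rewrite -!sum_tensor !mulr_sumr -big_split; apply: eq_bigr => x _ /=.
by rewrite /clique sign_clique mulrDr; congr (_ + _); rewrite mulrCA.
Qed.

Lemma sqrtC2_neq0 (C : numClosedFieldType) : sqrtC 2 != 0 :> C.
Proof. by rewrite sqrtC_eq0 pnatr_eq0. Qed.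

Lemma factor_TN (C : numClosedFieldType) (b : 'F_2) :
  (factor C 'i TN b = (sqrtC 2 *+ (b == 1))) *
  (factor C (- 'i) TN b = (sqrtC 2 *+ (b == 0))).
Proof.
have i2 : 'i * 'i = -1 :> C by rewrite -expr2 sqrCi.
have s2 : sqrtC 2 * sqrtC 2 = 2 :> C by rewrite -expr2 sqrtCK.
have s0 := sqrtC2_neq0 C.
rewrite /factor /ihn_mx /Nmx /mx2; case: (F2_cases b) => ->;
  rewrite !mxE /= ?mulr0n ?mulr1n; split; field: i2 s2 => //.
Qed.

(** I and H have real entries, so the two factors are complex conjugates, here of modulus 1. *)
Lemma factor_mul (C : numClosedFieldType) (t : ihn) (b : 'F_2) :
  t != TN -> factor C 'i t b * factor C (- 'i) t b = 1.
Proof.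
have i2 : 'i * 'i = -1 :> C by rewrite -expr2 sqrCi.
have s2 : sqrtC 2 * sqrtC 2 = 2 :> C by rewrite -expr2 sqrtCK.
have s0 := sqrtC2_neq0 C.
by case: t; rewrite ?ihn_eqE ?eqxx // => _; rewrite /factor /ihn_mx /Hmx /mx2;
  case: (F2_cases b) => ->; rewrite !mxE /= ?mulr0n ?mulr1n; field: i2 s2.
Qed.

(** The factor is 1 or e for I; for H it is (1 ± e) / sqrt 2, whose square is ± e. *)
Lemma factor_exp4 (C : numClosedFieldType) (t : ihn) (b : 'F_2) (e : C) :
  e * e = -1 -> t != TN -> factor C e t b ^+ 4 = (-1) ^+ (t == TH).
Proof.
move=> e2.
have s2 : sqrtC 2 * sqrtC 2 = 2 :> C by rewrite -expr2 sqrtCK.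
have s0 := sqrtC2_neq0 C.
by case: t; rewrite ?ihn_eqE ?eqxx // => _; rewrite /factor /ihn_mx /Hmx /mx2;
  case: (F2_cases b) => ->; rewrite !mxE /= ?mulr0n ?mulr1n; field: e2 s2.
Qed.

(** * Flatness in terms of the numbers of N's and H's *)

Definition positions (n : nat) (U : {ffun 'I_n -> ihn}) (t : ihn) : {set 'I_n} :=
  [set j | U j == t].

Lemma prod_sign_TH (S : comPzRingType) (n : nat) (U : {ffun 'I_n -> ihn}) :
  \prod_j (-1) ^+ (U j == TH) = (-1) ^+ #|positions n U TH| :> S.
Proof.
rewrite -sum1_card -prodrXr [RHS]big_mkcond /=.
by apply: eq_bigr => j _; rewrite inE; case: (U j == TH).
Qed.

(** Allows moduli to be read off fourth powers, where eighth roots of unity become signs. *)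
Lemma normC_eq1_exp4 (C : numClosedFieldType) (z : C) : `|z ^+ 4| = 1 -> `|z| = 1.
Proof. by rewrite normrX => /eqP; rewrite pexpr_eq1 // => /eqP. Qed.

Lemma flat_spectrum_no_TN (C : numClosedFieldType) (n : nat)
    (U : {ffun 'I_n -> ihn}) :
  positions n U TN = set0 ->
  flat (spectrum C (@clique n) U) = ~~ odd #|positions n U TH|.
Proof.
move=> noN; have neN j : U j != TN by have := in_set0 j; rewrite -noN inE => ->.
have i2 : 'i * 'i = -1 :> C by rewrite -expr2 sqrCi.
(* With P = z + w, z w = 1/2 and 4 z^4 = 4 w^4 = - (-1)^h, where h counts
   the H's: P^2 is 1 if h is even, 0 or 2 if h is odd. *)
have sqP k : ((spectrum C (@clique n) U k) ^+ 2 - 1) ^+ 2 =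
             (odd #|positions n U TH|)%:R.
  have exp4 (e : C) : e * e = -1 -> (\prod_j factor C e (U j) (k 0 j)) ^+ 4 =
      (-1) ^+ odd #|positions n U TH|.
    move=> e2; rewrite signr_odd -prod_sign_TH -prodrXl.
    by apply: eq_bigr => j _; rewrite factor_exp4.
  have A4 := exp4 _ i2; have B4 : _ = _ := exp4 (- 'i) (etrans (mulrNN _ _) i2).
  have AB : (\prod_j factor C 'i (U j) (k 0 j)) *
      (\prod_j factor C (- 'i) (U j) (k 0 j)) = 1.
    by rewrite -big_split big1 // => j _; exact: factor_mul.
  rewrite spectrum_clique; move: A4 B4 AB.
  set A := \prod_j _; set B := \prod_j _.
  by case: odd => A4 B4 AB; rewrite /= ?expr0 ?expr1 in A4 B4 *; field: i2 A4 B4 AB.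
apply/forallP/idP => [/(_ 0)/eqP P1 | evenH k].
  (* For odd h, P^2 is 0 or 2 at every k; the point k = 0 is enough to contradict |P| = 1. *)
  apply/negP => oddH; have := sqP 0; rewrite oddH.
  move: P1; set P := spectrum _ _ _ _ => P1 /eqP.
  rewrite sqrf_eq1 subr_eq subr_eq => /orP[] /eqP P2.
    by have /eqP := congr1 Num.norm P2; rewrite normrX P1 expr1n -(natrD _ 1 1) normr_nat (eqr_nat _ 1 2).
  by have /eqP := congr1 Num.norm P2; rewrite normrX P1 expr1n addNr normr0 oner_eq0.
have /eqP := sqP k; rewrite (negbTE evenH) sqrf_eq0 subr_eq0 => /eqP P2.
by apply/eqP/normC_eq1_exp4; rewrite (exprM _ 2 2) P2 expr1n normr1.
Qed.

(** The single N kills one product and scales the other by sqrt 2, which cancels |1 ± i| / 2 = 1 /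
    sqrt 2; the remaining factors have modulus 1. *)
Lemma flat_spectrum_one_TN (C : numClosedFieldType) (n : nat)
    (U : {ffun 'I_n -> ihn}) (j0 : 'I_n) :
  positions n U TN = [set j0] -> flat (spectrum C (@clique n) U).
Proof.
move=> oneN; have UN j : (U j == TN) = (j == j0).
  by have := in_set1 j j0; rewrite -oneN inE.
have i2 : 'i * 'i = -1 :> C by rewrite -expr2 sqrCi.
have s2 : sqrtC 2 * sqrtC 2 = 2 :> C by rewrite -expr2 sqrtCK.
have UN0 : U j0 = TN by apply/eqP; rewrite UN.
apply/forallP => k; apply/eqP/normC_eq1_exp4; rewrite spectrum_clique.
rewrite ![\prod_j _](bigD1 j0) //= UN0 !factor_TN.
have norm1 (e : C) : e * e = -1 ->
    `|\prod_(j | j != j0) factor C e (U j) (k 0 j)| = 1.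
  move=> e2; rewrite normr_prod big1 // => j nj.
  by apply: normC_eq1_exp4; rewrite factor_exp4 ?UN // normr_sign.
have := norm1 _ i2; have := norm1 (- 'i) (etrans (mulrNN _ _) i2).
set B := \prod_(j | _) _; set A := \prod_(j | _) _ => B1 A1.
case: (F2_cases (k 0 j0)) => -> /=; rewrite mulr1n mulr0n mul0r mulr0 ?add0r ?addr0.
  (* The coefficient is (1 + i)^4 (sqrt 2)^4 / 2^4 = (-4) 4 / 16 = -1. *)
  rewrite (_ : _ ^+ 4 = - B ^+ 4); last by field: i2 s2.
  by rewrite normrN normrX B1 expr1n.
rewrite (_ : _ ^+ 4 = - A ^+ 4); last by field: i2 s2.
by rewrite normrN normrX A1 expr1n.
Qed.

Lemma not_flat_spectrum_two_TN (C : numClosedFieldType) (n : nat)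
    (U : {ffun 'I_n -> ihn}) (j0 j1 : 'I_n) :
  U j0 = TN -> U j1 = TN -> j0 != j1 -> ~~ flat (spectrum C (@clique n) U).
Proof.
move=> U0 U1 j01; apply/forallPn.
(* The factor at j0 kills one product, the factor at j1 the other. *)
exists (\row_j (j == j1)%:R).
rewrite spectrum_clique (bigD1 j0) //= [X in _ + _ * X](bigD1 j1) //=.
rewrite U0 U1 !factor_TN !mxE (negbTE j01) eqxx /= mulr0n.
by rewrite !mul0r !mulr0 addr0 normr0 eq_sym oner_eq0.
Qed.

Lemma flat_spectrum_clique (C : numClosedFieldType) (n : nat)
    (U : {ffun 'I_n -> ihn}) :
  flat (spectrum C (@clique n) U) =
  (#|positions n U TN| == 1%N) ||
  (#|positions n U TN| == 0%N) && ~~ odd #|positions n U TH|.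
Proof.
case: (ltngtP #|positions n U TN| 1) => [||/eqP/cards1P[j0]].
- by rewrite ltnS leqn0 => /eqP/[dup] N0 /cards0_eq/flat_spectrum_no_TN ->; rewrite N0.
- move=> N2; rewrite (gtn_eqF (ltnW N2)) /=.
  case/card_gt1P: (N2) => j0 [j1 []]; rewrite !inE => /eqP U0 /eqP U1 j01.
  exact/negbTE/not_flat_spectrum_two_TN/j01.
- exact: flat_spectrum_one_TN.
Qed.

(** * Counting the flat transforms *)

Lemma card_one_TN (n : nat) :
  #|[set U : {ffun 'I_n -> ihn} | #|positions n U TN| == 1%N]| = (n * 2 ^ n.-1)%N.
Proof.
rewrite -sum1dep_card big_mkcond /=.
(* The product indicates that [j] is the only position of N, so at most one [j] contributes to the
   inner sum. *)
transitivity (\sum_(U : {ffun 'I_n -> ihn}) \sum_(j < n)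
    \prod_(i < n) ((U i == TN) == (i == j) : nat))%N.
  apply: eq_bigr => U _.
  have ind j : (\prod_(i < n) ((U i == TN) == (i == j) : nat))%N =
      (positions n U TN == [set j]).
    case: eqP => [/setP UN | neq].
      by apply: big1 => i _; have := UN i; rewrite !inE => ->; rewrite eqxx.
    case: (pickP (fun i => (U i == TN) != (i == j))) => [i ne|eq].
      by rewrite (bigD1 i) //= (negbTE ne) mul0n.
    by case: neq; apply/setP => i; rewrite !inE; have /negbFE/eqP := eq i.
  under eq_bigr => j _ do rewrite ind.
  case: cards1P => [[j ->]|neq].
    rewrite (bigD1 j) //= eqxx big1 // => i nij.
    by rewrite (inj_eq set1_inj) eq_sym (negbTE nij).
  by rewrite big1 // => j _; case: eqP => // eq; case: neq; exists j.
(* For fixed [j] the sum over [U] factors over the positions: one choice at [j], and two (I or H) at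
   each other position. *)
rewrite exchange_big /=.
under eq_bigr => j _.
  rewrite -(bigA_distr_bigA (fun i t => ((t == TN) == (i == j) : nat))) /=.
  rewrite (bigD1 j) //= sum_ihn !ihn_eqE !eqxx /= mul1n.
  rewrite (eq_bigr (fun=> 2%N)) => [|i /negbTE ->]; last first.
    by rewrite sum_ihn !ihn_eqE !eqxx.
  rewrite prod_nat_const cardC1 card_ord.
  over.
by rewrite sum_nat_const card_ord.
Qed.

(** A parity character sum: twice the count is (1 + 1)^n + (1 - 1)^n, whose second term vanishes for
    n > 0. *)
Lemma card_no_TN_even_TH (n : nat) : (0 < n)%N ->
  #|[set U : {ffun 'I_n -> ihn} |
      (#|positions n U TN| == 0%N) && ~~ odd #|positions n U TH|]| = (2 ^ n.-1)%N.
Proof.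
case: n => // n _; set E := [set U | _].
(* The signs of the character sum require a ring, hence the passage to [int]. *)
suff : (2 * #|E|)%:R = (2 ^ n.+1)%:R :> int.
  by move/eqP; rewrite eqr_nat expnS eqn_pmul2l // => /eqP.
rewrite -sum1dep_card big_mkcond /= natrM natr_sum mulr_sumr.
(* Twice the indicator of an even number of H's is 1 + (-1)^h. *)
transitivity (\sum_(U : {ffun 'I_n.+1 -> ihn})
    (\prod_i (U i != TN)%:R + \prod_i ((U i != TN)%:R * (-1) ^+ (U i == TH))) : int).
  apply: eq_bigr => U _; rewrite big_split prod_sign_TH -signr_odd /=.
  case: (posnP #|positions _ U TN|) => [/cards0_eq/setP N0 | /card_gt0P[j]].
    rewrite big1 => [|i _]; last by have := N0 i; rewrite !inE => ->.
    by case: odd.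
  by rewrite inE => /eqP Uj; rewrite (bigD1 j) //= Uj eqxx !mul0r addr0 mulr0.
rewrite big_split /= -(bigA_distr_bigA (fun=> fun t => (t != TN)%:R : int)).
rewrite -(bigA_distr_bigA (fun=> fun t => (t != TN)%:R * (-1) ^+ (t == TH) : int)).
rewrite !prodr_const card_ord !sum_ihn !ihn_eqE !eqxx /=.
by rewrite expr0 expr1 mulr1 mul1r mul0r !addr0 subrr expr0n addr0 -natrD -natrX.
Qed.

Lemma K_IHN_closed (C : numClosedFieldType) (n : nat) : (0 < n)%N ->
  K_IHN C n = (n.+1 * 2 ^ n.-1)%N.
Proof.
move=> n_gt0; rewrite mulSn addnC -{1}card_one_TN -(card_no_TN_even_TH _ n_gt0).
(* The two families are disjoint: the number of N's cannot be both 1 and 0. *)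
rewrite -cardsUI [X in (_ + X)%N]eq_card0 ?addn0 => [|U]; last first.
  by rewrite !inE; case: eqP => // ->.
by apply: eq_card => U; rewrite !inE flat_spectrum_clique.
Qed.

(** The recursion follows from the closed form at n and n - 1, both positive once n >= 2: 2 n
    2^(n-2) + 2^(n-1) = (n + 1) 2^(n-1). *)
Theorem lemma10 (R : realType) (n : nat) (hn : (1 <= n)%N) :
  ((2 <= n)%N ->
     K_IHN R[i] n = (2 * K_IHN R[i] n.-1 + 2 ^ n.-1)%N) /\
  K_IHN R[i] n = (n.+1 * 2 ^ n.-1)%N.
Proof.
split; last exact: K_IHN_closed.
case: n hn => [|[|n]] // _ _; rewrite !K_IHN_closed //=.
by rewrite mulnCA -expnS mulSn addnC.
Qed.
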